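(* Let $\sigma>0$ be constant and consider the 1D Jacobian-splitting active flux (semi-discrete) scheme with mesh size $\Delta x$ for the hyperbolic heat equation $p_t+\frac1\epsilon u_x=0$, $u_t+\frac1\epsilon p_x+\frac{\sigma}{\epsilon^2}u=0$, as written out in the context. Assume that its solution $(\bar p_i,\bar u_i,p_{i+\frac12},u_{i+\frac12})$ has a formal power series expansion in $\epsilon$ and is sufficiently regular, both in the sense of the context. Then, as $\epsilon\to0$ (i.e. upon equating the coefficients of equal powers of $\epsilon$), the leading order solutions satisfy, for all $i$, $$\bar u_i^{(0)}=u_{i+\frac12}^{(0)}=0,$$ $$\frac{\mathrm d}{\mathrm dt}\bar p_i^{(0)}=\frac{1}{2\sigma\Delta x}\Big[(D^+_{i+\frac12}+D^-_{i+\frac12})p^{(0)}-(D^+_{i-\frac12}+D^-_{i-\frac12})p^{(0)}\Big],\qquad(\mathrm A)$$ $$\frac{\mathrm d}{\mathrm dt}p_{i+\frac12}^{(0)}=\frac{1}{\sigma\Delta x}\Big[\tfrac12(D^+_{i-\frac12}+D^-_{i-\frac12})p^{(0)}-\tfrac{3}{\Delta x}\big(p^{(0)}_{i+\frac12}-p^{(0)}_{i-\frac12}\big)+\tfrac{3}{\Delta x}\big(p^{(0)}_{i+\frac32}-p^{(0)}_{i+\frac12}\big)-\tfrac12(D^+_{i+\frac32}+D^-_{i+\frac32})p^{(0)}\Big]+\mathcal O(\Delta x^3),\qquad(\mathrm B)$$ and (A), (B) are approximations of the heat equation $p^{(0)}_t=\frac1\sigma p^{(0)}_{xx}$ with truncation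 errors $\mathcal O(\Delta x^2)$; specifically, $$\frac{\mathrm d}{\mathrm dt}\bar p_i^{(0)}=\frac{1}{\sigma\Delta x}\Big(p^{(0)}_x(x_{i+\frac12},t)-p^{(0)}_x(x_{i-\frac12},t)\Big)+\mathcal O(\Delta x^2),\qquad \frac{\mathrm d}{\mathrm dt}p^{(0)}_{i+\frac12}=\frac1\sigma p^{(0)}_{xx}(x_{i+\frac12},t)+\mathcal O(\Delta x^2).$$
   Context: Mesh: uniform cells $I_i=[x_{i-\frac12},x_{i+\frac12}]$ of size $\Delta x=x_{i+\frac12}-x_{i-\frac12}$; indices $i$ range over $\mathbb Z$ (with periodic extension in the case of a periodic domain). Unknowns, functions of $t$: cell averages $\bar p_i,\bar u_i$ (attached to $I_i$) and point values $p_{i+\frac12},u_{i+\frac12}$ (attached to $x_{i+\frac12}$). Finite difference operators, for $q\in\{p,u\}$ (and likewise applied to the expansion coefficients $q^{(k)}$): $$D^+_{i+\frac12}q=\frac1{\Delta x}\big(2q_{i-\frac12}-6\bar q_i+4q_{i+\frac12}\big),\qquad D^-_{i+\frac12}q=\frac1{\Delta x}\big(-4q_{i+\frac12}+6\bar q_{i+1}-2q_{i+\frac32}\big).$$ Scheme ($0<\epsilon<1$, $\sigma>0$ constant): $$\frac{\mathrm d}{\mathrm dt}\bar p_i=-\frac1{\epsilon\Delta x}(u_{i+\frac12}-u_{i-\frac12}),\qquad \frac{\mathrm d}{\mathrm dt}\bar u_i=-\frac1{\epsilon\Delta x}(p_{i+\frac12}-p_{i-\frac12})-\frac{\sigma}{\epsilon^2}\bar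 u_i,$$ $$\frac{\mathrm d}{\mathrm dt}p_{i+\frac12}=-\frac1{2\epsilon}\Big[(D^+_{i+\frac12}-D^-_{i+\frac12})p+(D^+_{i+\frac12}+D^-_{i+\frac12})u\Big],$$ $$\frac{\mathrm d}{\mathrm dt}u_{i+\frac12}=-\frac1{2\epsilon}\Big[(D^+_{i+\frac12}+D^-_{i+\frac12})p+(D^+_{i+\frac12}-D^-_{i+\frac12})u\Big]-\frac\sigma{\epsilon^2}u_{i+\frac12}.$$ Formal expansion in $\epsilon$: each unknown $q\in\{\bar p_i,\bar u_i,p_{i+\frac12},u_{i+\frac12}\}$ is a formal power series $q=q^{(0)}+\epsilon q^{(1)}+\epsilon^2q^{(2)}+\dots$, with coefficients that are differentiable functions of $t$ independent of $\epsilon$, and the scheme holds as an identity of formal (Laurent) series in $\epsilon$, i.e. the coefficients of each power of $\epsilon$ agree. Sufficient regularity: for $k=0,1$ there is a function $p^{(k)}(x,t)$, $C^r$ in $x$ with $r$ sufficiently large, with $x$-derivatives up to order $r$ bounded uniformly in $x$, $t$ and $\Delta x$, such that $\bar p_i^{(k)}(t)=\frac1{\Delta x}\int_{I_i}p^{(k)}(x,t)\,\mathrm dx$ and $p_{i+\frac12}^{(k)}(t)=p^{(k)}(x_{i+\frac12},t)$ for all $i$. The symbols $\mathcal O(\Delta x^m)$ are for $\Delta x\to0$, with constants independent of $i$ and $\Delta x$. *)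

(* Defs.v *)
From Stdlib Require Import Reals ZArith.
From Coquelicot Require Import Coquelicot.
Open Scope R_scope.

(** ** Mesh and finite difference operators

    Cells and cell interfaces are both indexed by [Z]: for [qb q : Z -> R],
    [qb i] is the average over the cell [I_i] and [q i] is the point value at
    [x_{i+1/2}], so that [q (i - 1)] is the value at [x_{i-1/2}].
    A periodic domain corresponds to periodic sequences. *)

(** [xhalf x0 dx i] is [x_{i+1/2}]; the parameter [x0] is [x_{1/2}]. *)
Definition xhalf (x0 dx : R) (i : Z) : R := x0 + IZR i * dx.

(** [D^+_{i+1/2} q] and [D^-_{i+1/2} q]. *)
Definition Dp (dx : R) (qb q : Z -> R) (i : Z) : R :=
  / dx * (2 * q (i - 1)%Z - 6 * qb i + 4 * q i).

Definition Dm (dx : R) (qb q : Z -> R) (i : Z) : R :=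
  / dx * (- 4 * q i + 6 * qb (i + 1)%Z - 2 * q (i + 1)%Z).

(** [(D^+ + D^-)_{i+1/2} q] and [(D^+ - D^-)_{i+1/2} q]. *)
Definition Dsum (dx : R) (qb q : Z -> R) (i : Z) : R :=
  Dp dx qb q i + Dm dx qb q i.

Definition Ddiff (dx : R) (qb q : Z -> R) (i : Z) : R :=
  Dp dx qb q i - Dm dx qb q i.

(** ** Formal Laurent series in epsilon

    [a : fseries] stands for [sum_n (a n) eps^n].  Only linear operations and
    multiplication by powers of [eps] are needed; every series in use
    comes from a power series and so has finitely many negative powers. *)

Definition fseries : Type := Z -> R.

Definition fs_of_coeffs (q : nat -> R) : fseries :=
  fun n => if (n <? 0)%Z then 0 else q (Z.to_nat n).

Definition fs_eq (a b : fseries) : Prop := forall n, a n = b n.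
Definition fs_add (a b : fseries) : fseries := fun n => a n + b n.
Definition fs_opp (a : fseries) : fseries := fun n => - a n.
Definition fs_scal (c : R) (a : fseries) : fseries := fun n => c * a n.

(** [eps_pow m a] is the product [eps^m a]. *)
Definition eps_pow (m : Z) (a : fseries) : fseries := fun n => a (n - m)%Z.

Definition fs_derive (a : R -> fseries) (t : R) : fseries :=
  fun n => Derive (fun s => a s n) t.

(** Action of an [eps]-independent linear difference operator [D] (such as
    [Dsum dx]) on grid functions whose values are formal series. *)
Definition fs_lift (D : (Z -> R) -> (Z -> R) -> Z -> R)
    (qb q : Z -> fseries) (i : Z) : fseries :=
  fun n => D (fun j => qb j n) (fun j => q j n) i.

Declare Scope fs_scope.
Delimit Scope fs_scope with fs.
Notation "a == b" := (fs_eq a%fs b%fs) (at level 70) : fs_scope.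
Notation "a + b" := (fs_add a b) : fs_scope.
Notation "- a" := (fs_opp a) : fs_scope.
Notation "a - b" := (fs_add a (fs_opp b)) : fs_scope.
Notation "c * a" := (fs_scal c%R a) : fs_scope.

(** ** The Jacobian-splitting active flux scheme

    The equations at time [t], for unknowns with values in formal series. *)
Record scheme (sigma dx : R) (pb ub p u : Z -> R -> fseries) (t : R) : Prop := {
  scheme_pb : forall i,
    (fs_derive (pb i) t
     == - eps_pow (-1) (/ dx * (u i t - u (i - 1)%Z t)))%fs;
  scheme_ub : forall i,
    (fs_derive (ub i) t
     == - eps_pow (-1) (/ dx * (p i t - p (i - 1)%Z t))
        - eps_pow (-2) (sigma * ub i t))%fs;
  scheme_p : forall i,
    (fs_derive (p i) t
     == - eps_pow (-1) (/ 2 *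
            (fs_lift (Ddiff dx) (fun j => pb j t) (fun j => p j t) i
             + fs_lift (Dsum dx) (fun j => ub j t) (fun j => u j t) i)))%fs;
  scheme_u : forall i,
    (fs_derive (u i) t
     == - eps_pow (-1) (/ 2 *
            (fs_lift (Dsum dx) (fun j => pb j t) (fun j => p j t) i
             + fs_lift (Ddiff dx) (fun j => ub j t) (fun j => u j t) i))
        - eps_pow (-2) (sigma * u i t))%fs
}.

(** [q k i t] is the coefficient [q_i^(k)(t)] of [eps^k]. *)
Definition expand (q : nat -> Z -> R -> R) (i : Z) (t : R) : fseries :=
  fs_of_coeffs (fun k => q k i t).

Definition differentiable_coeffs (J : R -> Prop) (q : nat -> Z -> R -> R) : Prop :=
  forall k i t, J t -> ex_derive (q k i) t.

Definition formal_solution (sigma dx : R) (J : R -> Prop)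
    (pb ub p u : nat -> Z -> R -> R) : Prop :=
  differentiable_coeffs J pb /\ differentiable_coeffs J ub /\
  differentiable_coeffs J p /\ differentiable_coeffs J u /\
  forall t, J t -> scheme sigma dx (expand pb) (expand ub) (expand p) (expand u) t.

(** ** Regularity and asymptotics *)

Definition is_Cr (r : nat) (f : R -> R) : Prop :=
  (forall j x, (j <= r)%nat -> ex_derive_n f j x) /\
  (forall x, continuous (Derive_n f r) x).

(** [f x t] generates the averages [qb] and point values [q] on the mesh, and
    its [x]-derivatives up to order [r] exist and are bounded by [M]. *)
Definition regular (r : nat) (M x0 dx : R) (J : R -> Prop)
    (qb q : Z -> R -> R) (f : R -> R -> R) : Prop :=
  forall t, J t ->
    is_Cr r (fun x => f x t) /\
    (forall j x, (j <= r)%nat -> Rabs (Derive_n (fun y => f y t) j x) <= M) /\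
    (forall i, qb i t =
       / dx * RInt (fun x => f x t) (xhalf x0 dx (i - 1)) (xhalf x0 dx i)) /\
    (forall i, q i t = f (xhalf x0 dx i) t).

(** [e dx i t = O(dx^m)] as [dx -> 0] within the set [H] of mesh sizes,
    uniformly in [i] and in [t] in [J]. *)
Definition bigO_dx (H J : R -> Prop) (m : nat) (e : R -> Z -> R -> R) : Prop :=
  exists C dx0 : R, 0 < dx0 /\
    forall dx, H dx -> dx < dx0 ->
    forall i t, J t -> Rabs (e dx i t) <= C * dx ^ m.

(** ** Right-hand sides of the limit scheme *)

Definition limit_rhs_avg (sigma dx : R) (qb q : Z -> R) (i : Z) : R :=
  / (2 * sigma * dx) * (Dsum dx qb q i - Dsum dx qb q (i - 1)%Z).

Definition limit_rhs_pt (sigma dx : R) (qb q : Z -> R) (i : Z) : R :=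
  / (sigma * dx) *
  (/ 2 * Dsum dx qb q (i - 1)%Z
   - 3 / dx * (q i - q (i - 1)%Z)
   + 3 / dx * (q (i + 1)%Z - q i)
   - / 2 * Dsum dx qb q (i + 1)%Z).

(* Main.v *)
Require Import Defs.
From Stdlib Require Import Reals ZArith Lra Lia.
From Coquelicot Require Import Coquelicot.
Open Scope R_scope.

(** Equating the coefficients of [eps^-2], [eps^-1] and [eps^0] gives
    [u^(0) = 0], then [u^(1)] in terms of [p^(0)], and finally (A) and (B), where
    the error in (B) is exactly [- (1/2) (D^+ - D^-) p^(1)].  With a primitive
    [G] of [p^(k)], cell averages become differences of [G] and point values
    become values of [G'], so every stencil is a combination of values of [G]
    and its derivatives, and Taylor's formula at a single point gives all
    truncation errors. *)

(** * Matching powers of [eps] *)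

Lemma coefficient_equations (sigma dx : R) (J : R -> Prop)
    (pb ub p u : nat -> Z -> R -> R) (t : R) :
  0 < sigma -> formal_solution sigma dx J pb ub p u -> J t ->
  (forall i, ub 0%nat i t = 0 /\ u 0%nat i t = 0) /\
  (forall i, ub 1%nat i t = - / sigma * (/ dx * (p 0%nat i t - p 0%nat (i - 1)%Z t))) /\
  (forall i, u 1%nat i t =
     - / sigma * (/ 2 * Dsum dx (fun j => pb 0%nat j t) (fun j => p 0%nat j t) i)) /\
  (forall i, Derive (pb 0%nat i) t =
     - (/ dx * (u 1%nat i t - u 1%nat (i - 1)%Z t))) /\
  (forall i, Derive (p 0%nat i) t =
     - (/ 2 * (Ddiff dx (fun j => pb 1%nat j t) (fun j => p 1%nat j t) i +
               Dsum dx (fun j => ub 1%nat j t) (fun j => u 1%nat j t) i))).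
Proof.
intros Hs [_ [_ [_ [_ Hsch]]]] Jt.
destruct (Hsch t Jt) as [Epb Eub Ep Eu].
(* At [eps^-2] the time derivatives and the [eps^-1] fluxes involve only coefficients of negative
   index, which are zero; the damping term alone survives. *)
assert (H0 : forall i, ub 0%nat i t = 0 /\ u 0%nat i t = 0).
{ intros i.
  generalize (Eub i (-2)%Z) (Eu i (-2)%Z).
  unfold fs_derive, fs_add, fs_opp, eps_pow, fs_scal, fs_lift, expand, fs_of_coeffs,
    Ddiff, Dsum, Dp, Dm; simpl; rewrite !Derive_const.
  intros E1 E2; split; apply (Rmult_eq_reg_l sigma); lra. }
split; [exact H0|].
split; [|split; [|split]]; intros i.
- generalize (Eub i (-1)%Z).
  unfold fs_derive, fs_add, fs_opp, eps_pow, fs_scal, expand, fs_of_coeffs; simpl.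
  change (PosDef.Pos.to_nat 1) with 1%nat; rewrite Derive_const; intros E.
  apply (Rmult_eq_reg_l sigma); [|lra].
  rewrite <- Rmult_assoc, <- Ropp_mult_distr_r, Rinv_r by lra; lra.
- generalize (Eu i (-1)%Z).
  unfold fs_derive, fs_add, fs_opp, eps_pow, fs_scal, fs_lift, expand, fs_of_coeffs; simpl.
  change (PosDef.Pos.to_nat 1) with 1%nat; rewrite Derive_const; intros E.
  assert (Z0 : Ddiff dx (fun j => ub 0%nat j t) (fun j => u 0%nat j t) i = 0).
  { unfold Ddiff, Dp, Dm.
    destruct (H0 i) as [_ ->], (H0 (i - 1)%Z) as [_ ->], (H0 (i + 1)%Z) as [-> ->].
    destruct (H0 i) as [-> _]; ring. }
  rewrite Z0 in E.
  apply (Rmult_eq_reg_l sigma); [|lra].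
  rewrite <- Rmult_assoc, <- Ropp_mult_distr_r, Rinv_r by lra; lra.
- exact (Epb i 0%Z).
- exact (Ep i 0%Z).
Qed.

(** * Taylor expansions with uniform remainders *)

(** Factoring [h ^ S n] out of the Lagrange remainder leaves a [rho] bounded independently of [h],
    so stencils of expansions become polynomial identities in which each [rho] is a mere
    variable. *)
Lemma taylor_remainder (g : R -> R) (n : nat) (M c h k : R) :
  0 < h -> 0 < k ->
  (forall j x, (j <= S n)%nat -> ex_derive_n g j x) ->
  (forall x, Rabs (Derive_n g (S n) x) <= M) ->
  exists rho, Rabs rho <= k ^ S n * M /\
    g (c + k * h) =
    sum_f_R0 (fun m => (k * h) ^ m / INR (fact m) * Derive_n g m c) n
    + h ^ S n * rho.
Proof.
intros Hh Hk Hg HM.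
assert (Hkh : 0 < k * h) by now apply Rmult_lt_0_compat.
destruct (Taylor_Lagrange g n c (c + k * h)) as [z [_ Ez]]; [lra | now auto |].
replace (c + k * h - c) with (k * h) in Ez by ring.
exists (k ^ S n / INR (fact (S n)) * Derive_n g (S n) z).
assert (Hf : 1 <= INR (fact (S n))).
{ change 1 with (INR 1); apply le_INR, lt_O_fact. }
assert (Hkn : 0 < k ^ S n) by now apply pow_lt.
split.
- rewrite Rabs_mult, Rabs_pos_eq.
  + apply Rmult_le_compat; try apply Rabs_pos; auto.
    * apply Rlt_le, Rdiv_lt_0_compat; lra.
    * apply (Rmult_le_reg_r (INR (fact (S n)))); [lra|].
      unfold Rdiv; rewrite Rmult_assoc, Rinv_l by lra.
      apply Rmult_le_compat_l; lra.
  + apply Rlt_le, Rdiv_lt_0_compat; lra.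
- rewrite Ez, Rpow_mult_distr; unfold Rdiv; ring.
Qed.

(** [G 0] plays the role of a primitive of the density, [G 1] of the density
    itself; five derivatives of [G 0] are four of the density. *)
Definition jet5 (M : R) (G : nat -> R -> R) : Prop :=
  (forall j x, (j <= 4)%nat -> is_derive (G j) x (G (S j) x)) /\
  (forall x, Rabs (G 5%nat x) <= M).

Lemma jet5_Derive_n (M : R) (G : nat -> R -> R) (j m : nat) (x : R) :
  jet5 M G -> (m + j <= 5)%nat -> Derive_n (G j) m x = G (m + j)%nat x.
Proof.
intros [HG _]; revert x; induction m as [|m IH]; intros x Hm; [easy|].
simpl; rewrite (Derive_ext _ (G (m + j)%nat)) by (intros; apply IH; lia).
apply is_derive_unique, HG; lia.
Qed.

Lemma jet5_ex_derive_n (M : R) (G : nat -> R -> R) (j m : nat) (x : R) :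
  jet5 M G -> (m + j <= 5)%nat -> ex_derive_n (G j) m x.
Proof.
intros HG Hm; destruct m as [|m]; [easy|].
apply (ex_derive_ext (G (m + j)%nat)).
- intros y; symmetry; apply (jet5_Derive_n M); [exact HG | lia].
- eexists; apply HG; lia.
Qed.

(** The condition [S n + j = 5] puts [G 5] into every remainder, and [k <= 5] covers the widest
    stencil; hence one bound serves all expansions. *)
Lemma jet5_taylor (M : R) (G : nat -> R -> R) (c h k : R) (j n : nat) :
  jet5 M G -> (S n + j = 5)%nat -> 0 < h -> 1 <= k <= 5 ->
  exists rho, - (5 ^ 5 * M) <= rho <= 5 ^ 5 * M /\
    G j (c + k * h) =
    sum_f_R0 (fun m => (k * h) ^ m / INR (fact m) * G (m + j)%nat c) n
    + h ^ S n * rho.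
Proof.
intros HG Hnj Hh [Hk1 Hk5].
destruct (taylor_remainder (G j) n M c h k) as [rho [Hr E]]; [lra | lra | | |].
- intros m x Hm; apply (jet5_ex_derive_n M); [exact HG | lia].
- intros x; rewrite (jet5_Derive_n M), Hnj by (auto; lia); apply HG.
- assert (M0 : 0 <= M).
  { eapply Rle_trans; [apply Rabs_pos | apply (proj2 HG 0)]. }
  exists rho; split.
  + apply Rabs_le_between.
    eapply Rle_trans; [exact Hr|]; apply Rmult_le_compat_r; [exact M0|].
    apply Rle_trans with (5 ^ S n); [apply pow_incr; lra | apply Rle_pow; [lra | lia]].
  + rewrite E; f_equal; apply sum_eq; intros m Hm.
    rewrite (jet5_Derive_n M); [easy | exact HG | lia].
Qed.

Definition grid_data (G : nat -> R -> R) (a h : R) (qb q : Z -> R) : Prop :=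
  (forall i, qb i = / h * (G 0%nat (xhalf a h i) - G 0%nat (xhalf a h (i - 1)))) /\
  (forall i, q i = G 1%nat (xhalf a h i)).

Lemma xhalf_base (a h : R) (i d : Z) :
  xhalf a h (i + d) = xhalf a h (i - 3) + IZR (d + 3) * h.
Proof. unfold xhalf; rewrite minus_IZR, !plus_IZR; ring. Qed.

Lemma xhalf_center (a h : R) (i : Z) :
  xhalf a h i = xhalf a h (i - 3) + 3 * h.
Proof. unfold xhalf; rewrite minus_IZR; ring. Qed.

(** Expanding everything at [x_{i-5/2}], to the left of the stencils, makes
    one-sided Taylor formulas sufficient. *)
Ltac to_base i :=
  replace (i - 1 - 1)%Z with (i + -2)%Z by ring;
  replace (i + 1 - 1)%Z with (i + 0)%Z by ring;
  replace (i - 1 + 1)%Z with (i + 0)%Z by ring;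
  replace (i + 0 - 1)%Z with (i + -1)%Z by ring;
  replace (i + 1 + 1)%Z with (i + 2)%Z by ring;
  replace (i + 2 - 1)%Z with (i + 1)%Z by ring;
  replace (i - 1)%Z with (i + -1)%Z by ring;
  rewrite ?(xhalf_base _ _ i), ?(xhalf_center _ _ i); simpl Z.add.

(** Successive calls name their remainders [rho], [rho0], [rho1], ...; the closed formulas in the
    proofs below rely on this order. *)
Ltac expand_at HG Hh c j n k :=
  let rho := fresh "rho" in let Hr := fresh "Hr" in let E := fresh "E" in
  destruct (jet5_taylor _ _ c _ (IZR k) j n HG eq_refl Hh) as [rho [Hr E]];
  [split; apply IZR_le; discriminate |];
  simpl in E; rewrite ?E; clear E.

(** * Truncation errors of the stencils *)

(** [Ddiff] is [6 / h^2] times the error of Simpson's rule on two adjacent cells, which is exact on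
    cubics and otherwise of order [h^5]. *)
Lemma Ddiff_small (M : R) (G : nat -> R -> R) (a h : R) (qb q : Z -> R) (i : Z) :
  jet5 M G -> 0 < h -> grid_data G a h qb q ->
  Rabs (Ddiff h qb q i) <= 50 * (5 ^ 5 * M) * h ^ 3.
Proof.
intros HG Hh [Hb Hq].
assert (Hh3 : 0 < h ^ 3) by now apply pow_lt.
unfold Ddiff, Dp, Dm; rewrite !Hb, !Hq.
to_base i; set (c := xhalf a h (i - 3)).
set (K := 5 ^ 5 * M).
expand_at HG Hh c 0%nat 4%nat 2%Z.
expand_at HG Hh c 0%nat 4%nat 3%Z.
expand_at HG Hh c 0%nat 4%nat 4%Z.
expand_at HG Hh c 1%nat 3%nat 2%Z.
expand_at HG Hh c 1%nat 3%nat 3%Z.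
expand_at HG Hh c 1%nat 3%nat 4%Z.
fold K in Hr, Hr0, Hr1, Hr2, Hr3, Hr4.
(* The Taylor polynomials cancel, leaving the stencil applied to the remainders. Its absolute
   weights sum to 24; the two stencils below give 35 and 30, so 50 serves all three. *)
match goal with |- Rabs ?e <= _ =>
  replace e with ((2 * rho2 + 8 * rho3 + 2 * rho4 - 6 * (rho1 - rho)) * h ^ 3)
    by (simpl; field; lra) end.
rewrite Rabs_mult, (Rabs_pos_eq (h ^ 3)) by lra.
apply Rmult_le_compat_r; [lra|].
apply Rabs_le_between; lra.
Qed.

(** Half of [Dsum] approximates the first derivative, so the outer terms contribute -2 and the
    second difference 3 times the second derivative; by symmetry the first-order error vanishes. *)
Lemma limit_rhs_pt_consistent (M : R) (G : nat -> R -> R) (sigma a h : R)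
    (qb q : Z -> R) (i : Z) :
  0 < sigma -> jet5 M G -> 0 < h -> grid_data G a h qb q ->
  Rabs (limit_rhs_pt sigma h qb q i - / sigma * G 3%nat (xhalf a h i))
    <= / sigma * (50 * (5 ^ 5 * M)) * h ^ 2.
Proof.
intros Hs HG Hh [Hb Hq].
assert (Hh2 : 0 < h ^ 2) by now apply pow_lt.
assert (Hs' := Rinv_0_lt_compat _ Hs).
unfold limit_rhs_pt, Dsum, Dp, Dm; rewrite !Hb, !Hq.
to_base i; set (c := xhalf a h (i - 3)).
set (K := 5 ^ 5 * M).
expand_at HG Hh c 0%nat 4%nat 1%Z.
expand_at HG Hh c 0%nat 4%nat 2%Z.
expand_at HG Hh c 0%nat 4%nat 3%Z.
expand_at HG Hh c 0%nat 4%nat 4%Z.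
expand_at HG Hh c 0%nat 4%nat 5%Z.
expand_at HG Hh c 1%nat 3%nat 1%Z.
expand_at HG Hh c 1%nat 3%nat 2%Z.
expand_at HG Hh c 1%nat 3%nat 3%Z.
expand_at HG Hh c 1%nat 3%nat 4%Z.
expand_at HG Hh c 1%nat 3%nat 5%Z.
(* The exact value also has to be moved to the base point [c], three cells to the left. *)
expand_at HG Hh c 3%nat 1%nat 3%Z.
fold K in Hr, Hr0, Hr1, Hr2, Hr3, Hr4, Hr5, Hr6, Hr7, Hr8, Hr9.
match goal with |- Rabs ?e <= _ =>
  replace e with (/ sigma *
    ((rho4 - rho6) + 3 * ((rho1 - rho0) - (rho0 - rho))
     - ((rho6 - rho8) + 3 * ((rho3 - rho2) - (rho2 - rho1)))
     - 3 * (rho6 - rho5) + 3 * (rho7 - rho6) - rho9) * h ^ 2)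
    by (simpl; field; lra) end.
rewrite Rabs_mult, (Rabs_pos_eq (h ^ 2)) by lra.
apply Rmult_le_compat_r; [lra|].
rewrite Rabs_mult, (Rabs_pos_eq (/ sigma)) by lra.
apply Rmult_le_compat_l; [lra|].
apply Rabs_le_between; lra.
Qed.

(** Half of [Dsum] has leading error [- h^2 / 12] times the third derivative of the density;
    differencing this smooth error between neighbours regains the power of [h] lost to the
    division. *)
Lemma limit_rhs_avg_consistent (M : R) (G : nat -> R -> R) (sigma a h : R)
    (qb q : Z -> R) (i : Z) :
  0 < sigma -> jet5 M G -> 0 < h -> grid_data G a h qb q ->
  Rabs (limit_rhs_avg sigma h qb q i -
    / (sigma * h) * (G 2%nat (xhalf a h i) - G 2%nat (xhalf a h (i - 1))))
    <= / sigma * (50 * (5 ^ 5 * M)) * h ^ 2.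
Proof.
intros Hs HG Hh [Hb Hq].
assert (Hh2 : 0 < h ^ 2) by now apply pow_lt.
assert (Hs' := Rinv_0_lt_compat _ Hs).
unfold limit_rhs_avg, Dsum, Dp, Dm; rewrite !Hb, !Hq.
to_base i; set (c := xhalf a h (i - 3)).
set (K := 5 ^ 5 * M).
expand_at HG Hh c 0%nat 4%nat 1%Z.
expand_at HG Hh c 0%nat 4%nat 2%Z.
expand_at HG Hh c 0%nat 4%nat 3%Z.
expand_at HG Hh c 0%nat 4%nat 4%Z.
expand_at HG Hh c 1%nat 3%nat 1%Z.
expand_at HG Hh c 1%nat 3%nat 2%Z.
expand_at HG Hh c 1%nat 3%nat 3%Z.
expand_at HG Hh c 1%nat 3%nat 4%Z.
expand_at HG Hh c 2%nat 2%nat 2%Z.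
expand_at HG Hh c 2%nat 2%nat 3%Z.
fold K in Hr, Hr0, Hr1, Hr2, Hr3, Hr4, Hr5, Hr6, Hr7, Hr8.
match goal with |- Rabs ?e <= _ =>
  replace e with (/ sigma *
    ((rho4 - rho6) + 3 * ((rho2 - rho1) - (rho1 - rho0))
     - ((rho3 - rho5) + 3 * ((rho1 - rho0) - (rho0 - rho)))
     - (rho8 - rho7)) * h ^ 2)
    by (simpl; field; lra) end.
rewrite Rabs_mult, (Rabs_pos_eq (h ^ 2)) by lra.
apply Rmult_le_compat_r; [lra|].
rewrite Rabs_mult, (Rabs_pos_eq (/ sigma)) by lra.
apply Rmult_le_compat_l; [lra|].
apply Rabs_le_between; lra.
Qed.

(** * From the regularity assumption to jets *)

Lemma is_derive_primitive (f : R -> R) (x : R) :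
  (forall y, ex_derive f y) -> is_derive (fun y => RInt f 0 y) x (f x).
Proof.
intros Hf.
apply is_derive_RInt with 0.
- apply filter_forall; intros y; apply RInt_correct, ex_RInt_continuous.
  intros z _; now apply (ex_derive_continuous f).
- now apply (ex_derive_continuous f).
Qed.

Lemma regular_jet5 (r : nat) (M a h : R) (J : R -> Prop) (qb q : Z -> R -> R)
    (f : R -> R -> R) (t : R) :
  (4 <= r)%nat -> regular r M a h J qb q f -> J t ->
  exists G : nat -> R -> R,
    jet5 M G /\ grid_data G a h (fun j => qb j t) (fun j => q j t) /\
    forall j x, G (S j) x = Derive_n (fun y => f y t) j x.
Proof.
intros Hr Hreg Jt; destruct (Hreg t Jt) as [[Hex _] [HM [Hqb Hq]]].
assert (Hd : forall y, ex_derive (fun x => f x t) y).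
{ intros y; apply (Hex 1%nat); lia. }
assert (Hint : forall x y, ex_RInt (fun x => f x t) x y).
{ intros x y; apply (ex_RInt_continuous (V := R_CompleteNormedModule)).
  intros z _; apply (ex_derive_continuous (fun x => f x t)), Hd. }
exists (fun j => match j with
  | O => fun x => RInt (fun y => f y t) 0 x
  | S j => Derive_n (fun y => f y t) j end).
split; [split | split; [split |]].
- intros [|j] x Hj.
  + now apply is_derive_primitive.
  + apply Derive_correct, (Hex (S j)); lia.
- intros x; apply HM; lia.
- intros i; rewrite Hqb; f_equal.
  assert (E := RInt_Chasles (fun x => f x t) 0 (xhalf a h (i - 1)) (xhalf a h i)
    (Hint _ _) (Hint _ _)).
  change (RInt (fun x => f x t) 0 (xhalf a h (i - 1))
          + RInt (fun x => f x t) (xhalf a h (i - 1)) (xhalf a h i)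
          = RInt (fun x => f x t) 0 (xhalf a h i)) in E.
  lra.
- intros i; apply Hq.
- easy.
Qed.

(** The data are families indexed by the mesh size [dx], which ranges over a set
    [H]; [J] is the set of times, and [f dx k x t] is the function [p^(k)(x, t)]
    (which may depend on [dx]) of the regularity assumption. *)
Theorem proposition4p1 :
  exists r0 : nat, forall r : nat, (r0 <= r)%nat ->
  forall (sigma M : R) (H J : R -> Prop) (x0 : R -> R)
    (pb ub p u : R -> nat -> Z -> R -> R)
    (f : R -> nat -> R -> R -> R),
  0 < sigma ->
  open J ->
  (forall dx, H dx -> 0 < dx) ->
  (forall dx, H dx -> formal_solution sigma dx J (pb dx) (ub dx) (p dx) (u dx)) ->
  (forall dx, H dx -> forall k, (k <= 1)%nat ->
     regular r M (x0 dx) dx J (pb dx k) (p dx k) (f dx k)) ->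
  (forall dx, H dx -> forall i t, J t ->
     ub dx 0%nat i t = 0 /\ u dx 0%nat i t = 0) /\
  (forall dx, H dx -> forall i t, J t ->
     Derive (pb dx 0%nat i) t =
     limit_rhs_avg sigma dx (fun j => pb dx 0%nat j t) (fun j => p dx 0%nat j t) i) /\
  bigO_dx H J 3 (fun dx i t =>
     Derive (p dx 0%nat i) t -
     limit_rhs_pt sigma dx (fun j => pb dx 0%nat j t) (fun j => p dx 0%nat j t) i) /\
  bigO_dx H J 2 (fun dx i t =>
     Derive (pb dx 0%nat i) t -
     / (sigma * dx) *
       (Derive (fun x => f dx 0%nat x t) (xhalf (x0 dx) dx i) -
        Derive (fun x => f dx 0%nat x t) (xhalf (x0 dx) dx (i - 1)))) /\
  bigO_dx H J 2 (fun dx i t =>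
     Derive (p dx 0%nat i) t -
     / sigma * Derive_n (fun x => f dx 0%nat x t) 2 (xhalf (x0 dx) dx i)).
Proof.
exists 4%nat; intros r Hr sigma M H J x0 pb ub p u f Hs _ Hpos Hsol Hreg.
assert (Hs' := Rinv_0_lt_compat _ Hs).
assert (Havg : forall dx, H dx -> forall i t, J t ->
  Derive (pb dx 0%nat i) t =
  limit_rhs_avg sigma dx (fun j => pb dx 0%nat j t) (fun j => p dx 0%nat j t) i).
{ intros dx Hdx i t Jt; assert (Hh := Hpos dx Hdx).
  destruct (coefficient_equations _ _ _ _ _ _ _ t Hs (Hsol dx Hdx) Jt)
    as [_ [_ [Eu [Epb _]]]].
  rewrite Epb, !Eu; unfold limit_rhs_avg; field; lra. }
assert (Hpt : forall dx, H dx -> forall i t, J t ->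
  Derive (p dx 0%nat i) t =
  limit_rhs_pt sigma dx (fun j => pb dx 0%nat j t) (fun j => p dx 0%nat j t) i
  - / 2 * Ddiff dx (fun j => pb dx 1%nat j t) (fun j => p dx 1%nat j t) i).
{ intros dx Hdx i t Jt; assert (Hh := Hpos dx Hdx).
  destruct (coefficient_equations _ _ _ _ _ _ _ t Hs (Hsol dx Hdx) Jt)
    as [_ [Eub [Eu [_ Ep]]]].
  rewrite Ep; unfold limit_rhs_pt.
  (* Only the operator acting on [u^(1)] is opened. Its weight at [i] is [4 - 4 = 0], and its
     neighbours turn into the [Dsum] terms of (B), which stay opaque for [field]. *)
  unfold Dsum at 1, Dp at 1, Dm at 1; rewrite !Eub, !Eu.
  replace (i + 1 - 1)%Z with i by ring; field; lra. }
assert (Hdiff : forall dx, H dx -> forall i t, J t ->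
  Rabs (/ 2 * Ddiff dx (fun j => pb dx 1%nat j t) (fun j => p dx 1%nat j t) i)
    <= 25 * (5 ^ 5 * M) * dx ^ 3).
{ intros dx Hdx i t Jt.
  destruct (regular_jet5 _ _ _ _ _ _ _ _ t Hr (Hreg dx Hdx 1%nat (le_n 1)) Jt)
    as [G [HG [Hgrid _]]].
  rewrite Rabs_mult, (Rabs_pos_eq (/ 2)) by lra.
  generalize (Ddiff_small _ _ _ _ _ _ i HG (Hpos dx Hdx) Hgrid); lra. }
repeat apply conj.
- intros dx Hdx i t Jt.
  now apply (coefficient_equations _ _ _ _ _ _ _ t Hs (Hsol dx Hdx) Jt).
- exact Havg.
- exists (25 * (5 ^ 5 * M)), 1; split; [lra|].
  intros dx Hdx _ i t Jt; rewrite Hpt by assumption.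
  rewrite <- Rabs_Ropp; eapply Rle_trans; [right | now apply (Hdiff dx Hdx i t)].
  f_equal; ring.
- exists (/ sigma * (50 * (5 ^ 5 * M))), 1; split; [lra|].
  intros dx Hdx _ i t Jt; rewrite Havg by assumption.
  destruct (regular_jet5 _ _ _ _ _ _ _ _ t Hr (Hreg dx Hdx 0%nat (le_S _ _ (le_n 0))) Jt)
    as [G [HG [Hgrid EG]]].
  generalize (limit_rhs_avg_consistent _ _ _ _ _ _ _ i Hs HG (Hpos dx Hdx) Hgrid).
  now rewrite !EG.
- exists (/ sigma * (50 * (5 ^ 5 * M)) + 25 * (5 ^ 5 * M)), 1; split; [lra|].
  intros dx Hdx Hdx1 i t Jt; rewrite Hpt by assumption.
  assert (Hh := Hpos dx Hdx).
  destruct (regular_jet5 _ _ _ _ _ _ _ _ t Hr (Hreg dx Hdx 0%nat (le_S _ _ (le_n 0))) Jt)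
    as [G [HG [Hgrid EG]]].
  generalize (limit_rhs_pt_consistent _ _ _ _ _ _ _ i Hs HG Hh Hgrid)
    (Hdiff dx Hdx i t Jt).
  rewrite EG.
  set (E1 := limit_rhs_pt _ _ _ _ _); set (E2 := / 2 * _).
  set (E3 := / sigma * Derive_n _ _ _).
  intros B1 B2.
  assert (M0 : 0 <= M).
  { eapply Rle_trans; [apply Rabs_pos | apply (proj2 HG 0)]. }
  (* The cutoff [dx < 1] lets the third-order contribution of [p^(1)] be absorbed into the
     second-order bound. *)
  assert (Hp : 25 * (5 ^ 5 * M) * dx ^ 3 <= 25 * (5 ^ 5 * M) * dx ^ 2).
  { apply Rmult_le_compat_l; [lra|].
    assert (0 < dx ^ 2) by now apply pow_lt.
    change (dx ^ 3) with (dx * dx ^ 2); nra. }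
  replace (E1 - E2 - E3) with ((E1 - E3) - E2) by ring.
  eapply Rle_trans; [apply Rabs_triang|]; rewrite Rabs_Ropp; lra.
Qed.
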